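(* Let $r:\mathbb{R}^N\to\mathbb{R}^N$ be differentiable and let $\Phi_M\in\mathbb{R}^{N\times M}$, $M\le N$, be a reduced (POD) basis matrix with orthonormal columns. At iteration $k$ of the preconditioned LSPG Gauss--Newton procedure, let $r^{(k)}\in\mathbb{R}^N$ be the residual and $J^{(k)}\in\mathbb{R}^{N\times N}$ the (nonsingular) Jacobian of $r$ at the state iterate, let $M^{(k)}\in\mathbb{R}^{N\times N}$ be a nonsingular preconditioner matrix, and let $\delta w^{(k)}:=-(J^{(k)})^{-1}r^{(k)}$ be the full-order solution increment (search direction). Let $\delta\hat w^{(k)}$ be the generalized-coordinate increment of the preconditioned LSPG ROM, $$\delta\hat w^{(k)}\in\arg\min_{y\in\mathbb{R}^M}\left\|M^{(k)}\left(J^{(k)}\Phi_M y+r^{(k)}\right)\right\|_2^2.$$ 1. The LSPG ROM procedure minimizes at each iteration the error in the search direction in the norm given by $\Theta=(J^{(k)})^T(M^{(k)})^TM^{(k)}J^{(k)}$; that is, the minimization of $\left\|M^{(k)}\left(J^{(k)}\Phi_M y+r^{(k)}\right)\right\|_2^2$ over $y\in\mathbb{R}^M$ is the same as $$\delta\hat w^{(k)}\in\arg\min_{y\in\mathbb{R}^M}\left\|\Phi_M y-\delta w^{(k)}\right\|_{\Theta}^2,\qquad \Theta=(J^{(k)})^T(M^{(k)})^TM^{(k)}J^{(k)}.$$ Thus preconditioning changes the norm in which the increment error is minimized from the one given by $\Theta=(J^{(k)})^TJ^{(k)}$ (no preconditioning) to the one given by $\Theta=(J^{(k)})^T(M^{(k)})^TM^{(k)}J^{(k)}$.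 2. For the ideal preconditioner $M^{(k)}=(J^{(k)})^{-1}$, one has $\Theta=I$, and the increment yields an $\ell^2$-optimal projection of the solution increment $\delta w^{(k)}$ onto the reduced basis $\Phi_M$: $$\delta\hat w^{(k)}\in\arg\min_{y\in\mathbb{R}^M}\left\|\Phi_M y-\delta w^{(k)}\right\|_2^2.$$
   Context: For a symmetric positive-definite matrix $\Theta\in\mathbb{R}^{N\times N}$, $\|x\|_\Theta:=\sqrt{x^T\Theta x}$. The full-order model (FOM) is a nonlinear algebraic system $r(w)=0$ with $w\in\mathbb{R}^N$, solved by Newton's method with increments given by $J\,\delta w=-r$. A reduced-order model (ROM) seeks an approximate solution $\tilde w=w_0+\Phi_M\hat w$, where $w_0\in\mathbb{R}^N$ is a fixed reference state and $\hat w\in\mathbb{R}^M$ are generalized coordinates; the POD basis matrix satisfies $\Phi_M^T\Phi_M=I$. The (unpreconditioned) least-squares Petrov--Galerkin (LSPG) ROM solves $\min_{y\in\mathbb{R}^M}\|r(w_0+\Phi_My)\|_2^2$ by Gauss--Newton, with increments minimizing $\|J^{(k)}\Phi_My+r^{(k)}\|_2^2$ over $y\in\mathbb{R}^M$. The preconditioned LSPG ROM instead solves $\min_{y\in\mathbb{R}^M}\|\mathcal{M}\,r(w_0+\Phi_My)\|_2^2$ with a nonsingular preconditioner $\mathcal{M}\in\mathbb{R}^{N\times N}$, and its Gauss--Newton increments minimize $\|M^{(k)}(J^{(k)}\Phi_My+r^{(k)})\|_2^2$, where $M^{(k)}$ (the preconditioner at iteration $k$, not to be confused with the integer $M$) is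 nonsingular. In all these problems $J^{(k)}$ and $r^{(k)}$ are the same matrix and vector, evaluated at the same state. *)

(* Defs.v *)
From HB Require Import structures.
From mathcomp Require Import all_boot all_order all_algebra.
From mathcomp Require Import all_classical all_reals all_analysis.

Set Implicit Arguments.
Unset Strict Implicit.
Unset Printing Implicit Defensive.

Import Order.TTheory GRing.Theory Num.Theory.
Import numFieldNormedType.Exports.

Local Open Scope classical_set_scope.
Local Open Scope ring_scope.

Definition argmin (T : Type) (R : realType) (f : T -> R) : set T :=
  [set y | forall z, f y <= f z].

(* The norm `|x| carried by 'cV[R]_n is the sup norm, hence this one. *)
Definition l2norm (R : realType) (n : nat) (x : 'cV[R]_n) : R :=
  Num.sqrt (\sum_i x i 0 ^+ 2).

Definition spd (R : realType) (n : nat) (Theta : 'M[R]_n) : Prop :=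
  Theta^T = Theta /\
  forall x : 'cV[R]_n, x != 0 -> 0 < (x^T *m Theta *m x) 0 0.

(* Meaningful as a norm only for [spd Theta]. *)
Definition wnorm (R : realType) (n : nat) (Theta : 'M[R]_n) (x : 'cV[R]_n) : R :=
  Num.sqrt ((x^T *m Theta *m x) 0 0).

(* The library's [jacobian] acts on row vectors from the right, and so is the
   transpose of the Jacobian matrix of a map between column vectors. *)
Definition col_jacobian (R : realType) (m n : nat) (f : 'cV[R]_m -> 'cV[R]_n)
    (a : 'cV[R]_m) : 'M[R]_(n, m) :=
  \matrix_(i < n, j < m) ('D_(delta_mx j 0) f a) i 0.

Lemma derive_col_jacobian (R : realType) (m n : nat)
    (f : 'cV[R]_m -> 'cV[R]_n) (a v : 'cV[R]_m) :
  differentiable f a -> 'D_v f a = col_jacobian f a *m v.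
Proof.
move=> df; rewrite deriveE // {1}(matrix_sum_delta v) linear_sum /=.
apply/matrixP => i k; rewrite (ord1 k) summxE mxE; apply: eq_bigr => j _.
by rewrite big_ord1 linearZ /= !mxE deriveE // mulrC.
Qed.

(* Main.v *)
(* Since r = - J dw, the residual of the linearized system is the image of the
   increment error, J Phi y + r = J (Phi y - dw), and |A x|_2 is the norm of x
   weighted by A^T A.  Hence the two objectives agree pointwise. *)
Require Import Defs.
From HB Require Import structures.
From mathcomp Require Import all_boot all_order all_algebra.
From mathcomp Require Import all_classical all_reals all_analysis.
Import Order.TTheory GRing.Theory Num.Theory.
Import numFieldNormedType.Exports.
Local Open Scope classical_set_scope.
Local Open Scope ring_scope.

Lemma l2norm_mulmx (R : realType) (m n : nat) (A : 'M[R]_(m, n))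
    (x : 'cV[R]_n) : l2norm (A *m x) = wnorm (A^T *m A) x.
Proof.
rewrite /l2norm /wnorm mulmxA -trmx_mul -mulmxA mxE; congr Num.sqrt.
by apply: eq_bigr => i _; rewrite [in RHS]mxE expr2.
Qed.

(** The quadratic form at [x] is the sum of the squared entries of [A *m x]; it vanishes only if
    [A *m x = 0], which invertibility of [A] excludes for [x != 0]. This makes the weighted [wnorm]
    a genuine norm. *)
Lemma spd_gram (R : realType) (n : nat) (A : 'M[R]_n) :
  A \in unitmx -> spd (A^T *m A).
Proof.
move=> uA; split=> [|x x0]; first by rewrite trmx_mul trmxK.
have Ax0 : A *m x != 0.
  by apply: contra_neq x0 => Ax0; rewrite -(mulKmx uA x) Ax0 mulmx0.
rewrite mulmxA -trmx_mul -mulmxA mxE lt_neqAle.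
have ge0 i : true -> 0 <= (A *m x)^T 0 i * (A *m x) i 0.
  by rewrite [_^T _ _]mxE -expr2 sqr_ge0.
rewrite sumr_ge0 // andbT eq_sym; apply: contra_neq Ax0 => /psumr_eq0P s0.
apply/colP => i; move/eqP: (s0 ge0 i isT).
by rewrite [_^T _ _]mxE -expr2 sqrf_eq0 [RHS]mxE => /eqP.
Qed.

(** The double minus keeps the increment [- (invmx J *m b)] visible, so that the right-hand side
    matches [Phi *m y - dw] by unfolding alone. *)
Lemma residual_increment (R : realType) (m n : nat) (J : 'M[R]_n)
    (Phi : 'M[R]_(n, m)) (b : 'cV[R]_n) (y : 'cV[R]_m) :
  J \in unitmx -> J *m Phi *m y + b = J *m (Phi *m y - - (invmx J *m b)).
Proof. by move=> uJ; rewrite opprK mulmxDr mulKVmx // mulmxA. Qed.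

Theorem theorem2 (R : realType) (N M : nat) (hMN : (M <= N)%N)
    (r : 'cV[R]_N -> 'cV[R]_N) (hr : forall w, differentiable r w)
    (w0 : 'cV[R]_N) (Phi : 'M[R]_(N, M)) (hPhi : Phi^T *m Phi = 1%:M)
    (what : 'cV[R]_M) (Mk : 'M[R]_N) (dwhat : 'cV[R]_M) :
  let wk := w0 + Phi *m what in
  let rk := r wk in
  let Jk := col_jacobian r wk in
  let dw := - (invmx Jk *m rk) in
  let Theta := Jk^T *m Mk^T *m Mk *m Jk in
  let Theta0 := Jk^T *m Jk in
  let lspg := fun y : 'cV[R]_M => l2norm (Jk *m Phi *m y + rk) ^+ 2 in
  let plspg := fun y : 'cV[R]_M => l2norm (Mk *m (Jk *m Phi *m y + rk)) ^+ 2 in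
  Jk \in unitmx ->
  Mk \in unitmx ->
  argmin plspg dwhat ->
  [/\ [/\ spd Theta,
          argmin plspg = argmin (fun y => wnorm Theta (Phi *m y - dw) ^+ 2)
        & argmin (fun y => wnorm Theta (Phi *m y - dw) ^+ 2) dwhat],
      spd Theta0 /\
      argmin lspg = argmin (fun y => wnorm Theta0 (Phi *m y - dw) ^+ 2)
    & Mk = invmx Jk ->
      Theta = 1%:M /\ argmin (fun y => l2norm (Phi *m y - dw) ^+ 2) dwhat].
Proof.
move=> wk rk Jk dw Theta Theta0 lspg plspg uJ uM min_dwhat.
(* [Theta] is the Gram matrix of [Mk *m Jk], the form that [l2norm_mulmx] and [spd_gram] apply
   to. *)
have ThetaE : Theta = (Mk *m Jk)^T *m (Mk *m Jk).
  by rewrite /Theta trmx_mul !mulmxA.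
have plspgE : plspg = fun y => wnorm Theta (Phi *m y - dw) ^+ 2.
  apply/funext => y.
  by rewrite /plspg residual_increment // mulmxA l2norm_mulmx -ThetaE.
have lspgE : lspg = fun y => wnorm Theta0 (Phi *m y - dw) ^+ 2.
  by apply/funext => y; rewrite /lspg residual_increment // l2norm_mulmx.
split.
- by rewrite -plspgE ThetaE; split=> //; apply: spd_gram; rewrite unitmx_mul uM.
- by rewrite -lspgE; split=> //; exact: spd_gram.
- move=> MkE; split; first by rewrite ThetaE MkE mulVmx // trmx1 mulmx1.
  (* Here [Mk] cancels the factor [Jk] of the residual, so [plspg] is the unweighted objective
     directly, with no detour through [wnorm 1%:M]. *)
  suff <- : plspg = fun y => l2norm (Phi *m y - dw) ^+ 2 by [].
  by apply/funext => y; rewrite /plspg residual_increment // MkE mulKmx.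
Qed.
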